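(* Let $A$ be a generalized Cartan matrix, let $\mathfrak{g}$ be a Kac-Moody algebra of type $A$ with Cartan decomposition $\mathfrak{g}=\mathfrak{h}\oplus\bigoplus_{\alpha\in\Delta}\mathfrak{g}_\alpha$, and let $W$ be its Weyl group. For each $w\in W$ set $\Delta(w)=\{\alpha\in\Delta_+ \mid w.\alpha<0\}$ and let $\mathfrak{g}_w=\langle \mathfrak{g}_\alpha \mid \alpha\in\Delta(w)\rangle$ be the Lie subalgebra generated by the root spaces $\mathfrak{g}_\alpha$ with $\alpha\in\Delta(w)$. Then there is a constant $N$, depending only on $A$ (and not on $w$), such that for every $w\in W$ the Lie algebra $\mathfrak{g}_w$ is nilpotent of nilpotency degree at most $N$.
   Context: A generalized Cartan matrix here is a finite square integer matrix $A=(a_{ij})_{i,j\in I}$ with $a_{ii}=2$, $a_{ij}\le 0$ for $i\ne j$, and $a_{ij}=0$ if and only if $a_{ji}=0$; it need not be symmetrizable or indecomposable. The Kac-Moody algebra $\mathfrak{g}$ of type $A$ is the usual one over a field of characteristic $0$ (e.g. $\mathbb{C}$), with Cartan subalgebra $\mathfrak{h}$, simple roots $\Pi=\{\alpha_i\}_{i\in I}$, root system $\Delta=\Delta_+\sqcup\Delta_-$ (real and imaginary roots) and root spaces $\mathfrak{g}_\alpha$. The notation $\alpha>0$ (resp. $\alpha<0$) means $\alpha\in\Delta_+$ (resp. $\alpha\in\Delta_-$). The Weyl group $W$ is generated by the simple reflections and acts on $\Delta$. It is known that $\Delta(w)$ is finite and that $\mathfrak{g}_w$ is a finite-dimensional nilpotent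 subalgebra of $\mathfrak{g}$. The nilpotency degree of a nilpotent Lie algebra is its nilpotency class, i.e. the length of its lower central series. *)

(* Defs.v *)
From HB Require Import structures.
From mathcomp Require Import all_boot all_order all_algebra.
From mathcomp Require Import boolp classical_sets.

Set Implicit Arguments.
Unset Strict Implicit.
Unset Printing Implicit Defensive.

Import GRing.Theory.

Local Open Scope classical_set_scope.
Local Open Scope ring_scope.

HB.mixin Record Lmodule_isLie (R : comNzRingType) (L : Type)
    of GRing.Lmodule R L := {
  lie : L -> L -> L;
  lie_linearl : forall (a : R) (x y z : L),
    lie (a *: x + y) z = a *: lie x z + lie y z;
  lie_linearr : forall (a : R) (x y z : L),
    lie z (a *: x + y) = a *: lie z x + lie z y;
  liexx : forall x : L, lie x x = 0;
  lie_jacobi : forall x y z : L,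
    lie x (lie y z) + lie y (lie z x) + lie z (lie x y) = 0
}.

#[short(type="lieAlgType")]
HB.structure Definition LieAlgebra (R : comNzRingType) :=
  { L of GRing.Lmodule R L & Lmodule_isLie R L }.

Section LieAlgebraNotions.
Variables (F : fieldType) (L : lieAlgType F).
Implicit Types S T J : set L.

Definition subspace_set S : Prop :=
  S 0 /\ forall (a : F) (x y : L), S x -> S y -> S (a *: x + y).

Definition lie_subalgebra S : Prop :=
  subspace_set S /\ forall x y, S x -> S y -> S (lie x y).

Definition lie_ideal J : Prop :=
  subspace_set J /\ forall x y, J y -> J (lie x y).

Definition lin_span S : set L := smallest subspace_set S.

Definition lie_generated S : set L := smallest lie_subalgebra S.

Definition lie_bracket_set S T : set L :=
  lin_span [set z | exists x y, [/\ S x, T y & z = lie x y]].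

Fixpoint lower_central_series S (k : nat) : set L :=
  if k is k'.+1 then lie_bracket_set S (lower_central_series S k') else S.

(* The series starts at index 0 with [S] itself, so that the degree of a
   nonzero abelian algebra is 1.  [S] is nilpotent iff it has a degree. *)
Definition nilpotency_degree S (d : nat) : Prop :=
  lower_central_series S d = [set 0] /\
  forall k, lower_central_series S k = [set 0] -> (d <= k)%N.

End LieAlgebraNotions.

Definition lie_morphism (F : fieldType) (L M : lieAlgType F) (f : L -> M) :
    Prop :=
  (forall (a : F) (x y : L), f (a *: x + y) = a *: f x + f y) /\
  (forall x y : L, f (lie x y) = lie (f x) (f y)).

Definition generalized_cartan_matrix (n : nat) (A : 'M[int]_n) : Prop :=
  [/\ forall i, A i i = 2,
      forall i j, i != j -> A i j <= 0 &
      forall i j, A i j = 0 <-> A j i = 0].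

Definition dual_space (F : fieldType) (V : vectType F) : vectType F :=
  'Hom(V, F^o).

(* [cartan_dim] says dim h = 2n - rank A (minimal realization). *)
Record realization (n : nat) (A : 'M[int]_n) (F : fieldType) := Realization {
  cartan : vectType F;
  simple_root : 'I_n -> dual_space cartan;
  simple_coroot : 'I_n -> cartan;
  simple_root_free : free [seq simple_root i | i <- enum 'I_n];
  simple_coroot_free : free [seq simple_coroot i | i <- enum 'I_n];
  root_coroot : forall i j,
    simple_root j (simple_coroot i) = (A i j)%:~R :> F;
  cartan_dim :
    (\dim (fullv : {vspace cartan}) +
     \rank (\matrix_(i, j) (A i j)%:~R : 'M[F]_n) = 2 * n)%N
}.

Section KacMoody.
Variables (n : nat) (A : 'M[int]_n) (F : fieldType) (R : realization A F).
Local Notation H := (cartan R).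

Record chevalley_relations (L : lieAlgType F)
    (e f : 'I_n -> L) (iota : H -> L) : Prop := {
  iota_linear : forall (a : F) (h h' : H),
    iota (a *: h + h') = a *: iota h + iota h';
  lie_ef : forall i j,
    lie (e i) (f j) = if i == j then iota (simple_coroot R i) else 0;
  lie_hh : forall h h', lie (iota h) (iota h') = 0;
  lie_he : forall h i, lie (iota h) (e i) = (simple_root R i h : F) *: e i;
  lie_hf : forall h i, lie (iota h) (f i) = - ((simple_root R i h : F) *: f i)
}.

(* The algebra commonly denoted by g with a tilde: it is presented by the
   generators e_i, f_i, h and the above relations, hence is determined up to
   isomorphism. *)
Record presented_by_chevalley (L : lieAlgType F)
    (e f : 'I_n -> L) (iota : H -> L) : Prop := {
  presented_relations : chevalley_relations e f iota;
  presented_generated :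
    lie_generated (range e `|` range f `|` range iota) = setT;
  presented_universal :
    forall (M : lieAlgType F) (e' f' : 'I_n -> M) (iota' : H -> M),
    chevalley_relations e' f' iota' ->
    exists phi : L -> M,
      [/\ lie_morphism phi, forall i, phi (e i) = e' i,
          forall i, phi (f i) = f' i & forall h, phi (iota h) = iota' h]
}.

Definition trivial_on_cartan (L : lieAlgType F) (iota : H -> L) (J : set L) :
    Prop :=
  J `&` range iota `<=` [set 0].

Definition largest_ideal_trivial_on_cartan (L : lieAlgType F) (iota : H -> L)
    (J : set L) : Prop :=
  [/\ lie_ideal J, trivial_on_cartan iota J &
      forall K, lie_ideal K -> trivial_on_cartan iota K -> K `<=` J].

(* g is the quotient of the algebra presented above by its largest ideal
   meeting h trivially; the Serre relations then hold in g.  The quotient is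
   expressed by a surjection [pi] with that kernel. *)
Record kac_moody_algebra := KacMoodyAlgebra {
  km_sort :> lieAlgType F;
  km_e : 'I_n -> km_sort;
  km_f : 'I_n -> km_sort;
  km_cartan : H -> km_sort;
  km_quotient :
    exists (L : lieAlgType F) (e f : 'I_n -> L) (iota : H -> L)
           (pi : L -> km_sort),
      [/\ presented_by_chevalley e f iota,
          lie_morphism pi /\ range pi = setT,
          largest_ideal_trivial_on_cartan iota [set x | pi x = 0] &
          [/\ forall i, km_e i = pi (e i), forall i, km_f i = pi (f i) &
              forall h, km_cartan h = pi (iota h)]]
}.

Variable g : kac_moody_algebra.

Definition root_space (a : dual_space H) : set g :=
  [set x | forall h : H, lie (km_cartan g h) x = (a h : F) *: x].

Definition km_root : set (dual_space H) :=
  [set a | a != 0 /\ exists x, root_space a x /\ x != 0].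

Definition positive_root : set (dual_space H) :=
  [set a | km_root a /\
     exists c : 'I_n -> nat, a = \sum_(i < n) simple_root R i *+ c i].

Definition negative_root : set (dual_space H) :=
  [set a | km_root a /\
     exists c : 'I_n -> nat, a = - \sum_(i < n) simple_root R i *+ c i].

Definition simple_reflection (i : 'I_n) (a : dual_space H) : dual_space H :=
  a - (a (simple_coroot R i) : F) *: simple_root R i.

Inductive weyl_group : (dual_space H -> dual_space H) -> Prop :=
| weyl_id : weyl_group id
| weyl_reflection i : weyl_group (simple_reflection i)
| weyl_comp u v : weyl_group u -> weyl_group v -> weyl_group (u \o v)
| weyl_inv u v : weyl_group u -> cancel u v -> cancel v u -> weyl_group v.

Definition inversion_set (w : dual_space H -> dual_space H) :
    set (dual_space H) :=
  [set a | positive_root a /\ negative_root (w a)].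

Definition inversion_subalgebra (w : dual_space H -> dual_space H) : set g :=
  lie_generated (\bigcup_(a in inversion_set w) root_space a).

End KacMoody.

Arguments km_root {n A F R} g.
Arguments positive_root {n A F R} g.
Arguments negative_root {n A F R} g.
Arguments root_space {n A F R} g a.
Arguments inversion_set {n A F R} g w.
Arguments inversion_subalgebra {n A F R} g w.

(* Main.v *)
Require Import Defs.
From HB Require Import structures.
From mathcomp Require Import all_boot all_order all_algebra.
From mathcomp Require Import boolp classical_sets.
From mathcomp Require Import zify ring.

(** Every root inverted by [w] is real, and the set Phi(w) of inverted roots is
    finite and closed under those sums that are roots.  Hence a nonzero k-fold
    bracket in [g_w] yields a chain gamma_0, ..., gamma_k in Phi(w) whose
    successive differences lie in Phi(w), and it suffices to bound k.

    Reduce the coordinates of the gamma_i in the basis of simple roots modulo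
    6.  If k >= 6^n, two members gamma and gamma' = gamma + B, with B a nonempty
    sum of elements of Phi(w), are congruent.  Write B as a sum of elements of
    Phi(w) with as few terms as possible.  Two roots beta, beta' of Phi(w) with
    <beta, beta'^v> < 0 satisfy <beta, beta'^v><beta', beta^v> <= 3, since Phi(w)
    is finite; so their sum is a reflection of one of them and could be merged.
    Thus the terms of B have pairwise nonnegative pairings, and
    <B, beta^v> >= 2 for each term beta.  By the congruence <B, beta^v> >= 6,
    and as <gamma, beta^v> >= -3 we get <gamma', beta^v> > 0, hence
    <beta, gamma'^v> > 0, and <B, gamma'^v> > 0.  But <gamma, gamma'^v> is
    congruent to 2 modulo 6 and at least -3, so it is at least 2 and
    <B, gamma'^v> = 2 - <gamma, gamma'^v> <= 0. *)

Set Implicit Arguments.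
Unset Strict Implicit.
Unset Printing Implicit Defensive.

Import Order.TTheory GRing.Theory Num.Theory.

Local Open Scope classical_set_scope.
Local Open Scope ring_scope.

(** * Inversions in a root system over the integers *)

Section Pairing.
Variable n : nat.
Implicit Types (x v : 'rV[int]_n) (c d : 'cV[int]_n).

(** Rows are coordinates in the simple roots, columns integral functionals on the root lattice. *)
Definition pairing x c : int := (x *m c) 0 0.

Lemma pairingD x y c : pairing (x + y) c = pairing x c + pairing y c.
Proof. by rewrite /pairing mulmxDl mxE. Qed.

Lemma pairingZ k x c : pairing (k *: x) c = k * pairing x c.
Proof. by rewrite /pairing -scalemxAl mxE. Qed.

Lemma pairingN x c : pairing (- x) c = - pairing x c.
Proof. by rewrite -scaleN1r pairingZ mulN1r. Qed.

Lemma pairingB x y c : pairing (x - y) c = pairing x c - pairing y c.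
Proof. by rewrite pairingD pairingN. Qed.

Lemma pairing_sum (l : seq 'rV[int]_n) c :
  pairing (\sum_(x <- l) x) c = \sum_(x <- l) pairing x c.
Proof.
by apply: (big_morph (pairing^~ c)) => [x y|]; rewrite ?pairingD // /pairing mul0mx mxE.
Qed.

Definition reflection v c x : 'rV[int]_n := x - pairing x c *: v.

Lemma reflectionP v c k x y :
  reflection v c (k *: x + y) = k *: reflection v c x + reflection v c y.
Proof.
rewrite /reflection pairingD pairingZ scalerBr scalerA scalerDl opprD.
by rewrite addrACA.
Qed.

Lemma pairing_reflection v c d x :
  pairing (reflection v c x) d = pairing x (d - pairing v d *: c).
Proof.
rewrite pairingB pairingZ mulrC [RHS]/pairing mulmxBr -scalemxAr.
by rewrite [RHS]mxE [(- _ : 'M_1) 0 0]mxE [(_ *: _ : 'M_1) 0 0]mxE.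
Qed.

Lemma row_intD x v i : (x + v) 0 i = x 0 i + v 0 i. Proof. exact: mxE. Qed.

Lemma row_intN v i : (- v) 0 i = - v 0 i. Proof. exact: mxE. Qed.

Lemma row_intZ (k : int) v i : (k *: v) 0 i = k * v 0 i. Proof. exact: mxE. Qed.

Lemma row_int0 i : (0 : 'rV[int]_n) 0 i = 0. Proof. exact: mxE. Qed.

Definition row_intE := (row_intD, row_intN, row_intZ, row_int0).

Definition nonneg_vec v : Prop := forall i, 0 <= v 0 i.

Lemma seq_bounded (s : seq 'rV[int]_n) (h : 'rV[int]_n -> int) :
  exists B : nat, forall v, v \in s -> h v <= B%:Z.
Proof.
elim: s => [|a s [B hB]]; first by exists 0%N.
exists (`|h a| + B)%N => v; rewrite inE => /orP[/eqP->|/hB]; lia.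
Qed.

End Pairing.

(** * Simple reflections, coroots and inversion sets of words *)

Section RealRoots.
Variables (n : nat) (A : 'M[int]_n).
Local Notation V := 'rV[int]_n.
Implicit Types (t : seq 'I_n) (v x : V).

Definition simple_vec (i : 'I_n) : V := delta_mx 0 i.
(** The simple coroot as a functional: it takes the value [A i j] on [simple_vec j]. *)
Definition simple_covec (i : 'I_n) : 'cV[int]_n := (row i A)^T.
Definition simple_refl i : V -> V := reflection (simple_vec i) (simple_covec i).
Definition word_action t : V -> V := foldr (fun i f => simple_refl i \o f) id t.

Lemma word_actionP t k x y :
  word_action t (k *: x + y) = k *: word_action t x + word_action t y.
Proof. by elim: t => [//|i t IH] /=; rewrite IH /simple_refl reflectionP. Qed.

Lemma word_actionD t x y : word_action t (x + y) = word_action t x + word_action t y.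
Proof. by rewrite -[x in LHS]scale1r word_actionP scale1r. Qed.

Lemma word_action0 t : word_action t 0 = 0.
Proof. by apply: (addrI (word_action t 0)); rewrite -word_actionD !addr0. Qed.

Lemma word_actionZ t k x : word_action t (k *: x) = k *: word_action t x.
Proof. by rewrite -[k *: x]addr0 word_actionP word_action0 addr0. Qed.

Lemma word_actionN t x : word_action t (- x) = - word_action t x.
Proof. by rewrite -scaleN1r word_actionZ scaleN1r. Qed.

Lemma word_action_cat t1 t2 x :
  word_action (t1 ++ t2) x = word_action t1 (word_action t2 x).
Proof. by elim: t1 => [//|i t1 IH] /=; rewrite IH. Qed.

(** The adjoint of a word; it supplies the coroot in [coroot_of_word]. *)
Lemma pairing_word_action t c : exists d, forall x, pairing (word_action t x) c = pairing x d.
Proof.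
elim: t c => [|i t IH] c; first by exists c.
have [d hd] := IH (c - pairing (simple_vec i) c *: simple_covec i).
by exists d => x; rewrite /= pairing_reflection hd.
Qed.

Hypothesis A_diag : forall i, A i i = 2.

Lemma pairing_simple i : pairing (simple_vec i) (simple_covec i) = 2.
Proof. by rewrite /pairing /simple_vec -rowE !mxE A_diag. Qed.

Lemma simple_reflK i : involutive (simple_refl i).
Proof.
move=> x; rewrite /simple_refl /reflection pairingB pairingZ pairing_simple.
by rewrite -addrA -opprD -scalerDl; apply/rowP=> j; rewrite !row_intE; ring.
Qed.

Lemma word_actionK t : cancel (word_action t) (word_action (rev t)).
Proof.
elim: t => [//|i t IH] x.
by rewrite rev_cons -cats1 word_action_cat /= simple_reflK IH.
Qed.

Lemma word_actionVK t : cancel (word_action (rev t)) (word_action t).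
Proof. by move=> x; have := word_actionK (rev t) x; rewrite revK. Qed.

(* Stands for "[c] is the coroot of the real root [v]"; the uniqueness of [c]
   is never needed. *)
Definition coroot_of v c : Prop :=
  pairing v c = 2 /\ exists t, forall x, word_action t x = reflection v c x.

Lemma coroot_of_opp v c : coroot_of v c -> coroot_of (- v) (- c).
Proof.
have pN x : pairing x (- c) = - pairing x c by rewrite /pairing mulmxN mxE.
case=> v2 [t ht]; split; first by rewrite pairingN pN opprK.
by exists t => x; rewrite ht /reflection pN scaleNr scalerN opprK.
Qed.

(** The reflection in the image of a simple root is a conjugate of a simple reflection, hence again
    a word. *)
Lemma coroot_of_word t i :
  exists c, coroot_of (word_action (rev t) (simple_vec i)) c.
Proof.
have [c hc] := pairing_word_action t (simple_covec i).
exists c; split; last first.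
  exists (rev t ++ i :: t) => x; rewrite word_action_cat /= /simple_refl /reflection.
  by rewrite word_actionD word_actionN word_actionZ word_actionK hc.
by rewrite -hc word_actionVK pairing_simple.
Qed.

(** An abstract root set, imaginary roots included; the hypotheses on it are proved for the roots of
    the Kac-Moody algebra as [root_vec_neq0] up to [root_vec_multiple]. *)
Variable root : V -> Prop.
Hypothesis root_neq0 : ~ root 0.
Hypothesis root_sign : forall v, root v -> nonneg_vec v \/ nonneg_vec (- v).
Hypothesis root_refl : forall i v, root v -> root (simple_refl i v).
Hypothesis root_multiple : forall i v,
  root v -> nonneg_vec v -> (forall j, j != i -> v 0 j = 0) -> v = simple_vec i.

Definition inversion t v : Prop :=
  [/\ root v, nonneg_vec v & nonneg_vec (- word_action t v)].

Lemma root_word_action t v : root v -> root (word_action t v).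
Proof. by elim: t => [//|i t IH] /= /IH; exact: root_refl. Qed.

Lemma root_reflection v c x : coroot_of v c -> root x -> root (reflection v c x).
Proof. by case=> _ [t ht] hx; rewrite -ht; apply: root_word_action. Qed.

Lemma nonneg_vec_opp_eq0 v : nonneg_vec v -> nonneg_vec (- v) -> v = 0.
Proof. by move=> h1 h2; apply/rowP=> i; move: (h1 i) (h2 i); rewrite !row_intE; lia. Qed.

Lemma simple_refl_coord i v j : j != i -> simple_refl i v 0 j = v 0 j.
Proof.
by move=> ji; rewrite /simple_refl /reflection !mxE (negPf ji) andbF mulr0 subr0.
Qed.

(** A simple reflection changes only the [i]-th coordinate, so the other coordinates of [v] have
    both signs and vanish. *)
Lemma simple_refl_inversion i v :
  root v -> nonneg_vec v -> nonneg_vec (- simple_refl i v) -> v = simple_vec i.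
Proof.
move=> rv pv nv; apply: root_multiple => // j ji.
by move: (pv j) (nv j); rewrite row_intE simple_refl_coord //; lia.
Qed.

(** Prefixing a letter [i] adds at most one inversion, the preimage under [t] of the simple root
    [i]; in particular all inversions are real. *)
Lemma inversion_finite t :
  exists s : seq V, forall v, inversion t v -> v \in s /\ exists c, coroot_of v c.
Proof.
elim: t => [|i t [s hs]].
  exists [::] => v [rv pv nv]; case: root_neq0.
  by rewrite -(nonneg_vec_opp_eq0 pv nv).
exists (word_action (rev t) (simple_vec i) :: s) => v [rv pv nv].
have rt := root_word_action t rv.
have [pt|nt] := root_sign rt; last first.
  by have [vs hc] := hs v (And3 rv pv nt); rewrite inE vs orbT.
have e := simple_refl_inversion rt pt nv.
have -> : v = word_action (rev t) (simple_vec i) by rewrite -e word_actionK.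
by split; [rewrite inE eqxx | exact: coroot_of_word].
Qed.

Lemma inversion_coroot t v : inversion t v -> exists c, coroot_of v c.
Proof. by have [s hs] := inversion_finite t => /hs[]. Qed.

Lemma inversion_comb t u v (x y : int) : inversion t u -> inversion t v ->
  0 <= x -> 0 <= y -> root (x *: u + y *: v) -> inversion t (x *: u + y *: v).
Proof.
move=> [_ pu nu] [_ pv nv] x0 y0 r; split=> // i.
  by rewrite !row_intE addr_ge0 // mulr_ge0.
move: (nu i) (nv i); rewrite word_actionD !word_actionZ !row_intE; nia.
Qed.

(** * Pairings between two real roots *)

Section Pairs.
Variables (u v : V) (cu cv : 'cV[int]_n).
Hypotheses (hu : coroot_of u cu) (hv : coroot_of v cv).

(** With coordinates [x], [- y] and nonnegative [a], [b], the product of the reflections is minus a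
    map preserving the cone of nonnegative [x], [y]. *)
Lemma reflection2 (a b x y : int) : pairing u cv = - a -> pairing v cu = b ->
  reflection u cu (reflection v cv (x *: u - y *: v)) =
  - (((1 + a * b) * x + b * y) *: u - (a * x + y) *: v).
Proof.
move=> ha hb; rewrite /reflection.
have [u2 _] := hu; have [v2 _] := hv.
rewrite !(pairingB, pairingZ) u2 v2 ha hb.
by apply/rowP=> i; rewrite !row_intE; ring.
Qed.

(* Otherwise [reflection u cu \o reflection v cv] acts on the span of [u] and
   [v] as minus a hyperbolic or unipotent map, and it inverts infinitely many
   of the roots in the orbit of [u]. *)
Lemma pairing_neg_sym : root u -> nonneg_vec u ->
  pairing u cv < 0 -> pairing v cu < 0.
Proof.
move=> ru pu ltuv; rewrite ltNge; apply/negP=> b0.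
set a' : int := - pairing u cv; set b' : int := pairing v cu.
have a0 : 0 < a' by rewrite oppr_gt0.
have ha : pairing u cv = - a' by rewrite opprK.
have u2 := hu.1; have v2 := hv.1.
have [tu htu] := hu.2; have [tv htv] := hv.2.
set t := tu ++ tv.
pose w (x y : int) : V := x *: u - y *: v.
pose X (x y : int) : int := (1 + a' * b') * x + b' * y.
pose Y (x y : int) : int := a' * x + y.
(* [Q x y] is [y * X x y - x * Y x y], the determinant of a pair and its image, and is invariant
   since the map has determinant 1. It is [- a'] at (1, 0), and [Q <= 0] says that the slope [y / x]
   does not decrease. *)
pose Q (x y : int) : int := a' * b' * (x * y) + b' * (y * y) - a' * (x * x).
have tw (x y : int) : word_action t (w x y) = - w (X x y) (Y x y).
  by rewrite word_action_cat htv htu (reflection2 x y ha (erefl b')).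
have QE (x y : int) : Q (X x y) (Y x y) = Q x y by rewrite /Q /X /Y; ring.
have bX (x y : int) : 1 <= x -> 0 <= y -> 1 <= X x y.
  move=> x1 y0; rewrite /X; have : 0 <= b' * y by rewrite mulr_ge0.
  have : 0 <= a' * b' * x by rewrite !mulr_ge0 //; lia.
  by rewrite mulrDl mul1r; lia.
have bY (x y k : int) : 1 <= x -> k <= y -> k + 1 <= Y x y.
  by move=> x1 ky; rewrite /Y; nia.
have mono (x y : int) : 1 <= x -> 0 < y -> Q x y <= 0 ->
    nonneg_vec (- w x y) -> nonneg_vec (- w (X x y) (Y x y)).
  move=> x1 y0 hQ h i; move: (h i) (pu i); rewrite !row_intE => hi ui.
  rewrite -(pmulr_rge0 _ y0).
  have -> : y * - (X x y * u 0 i - Y x y * v 0 i) =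
     Y x y * - (x * u 0 i - y * v 0 i) + (- Q x y) * u 0 i.
    by rewrite /Q /X /Y; ring.
  rewrite addr_ge0 // mulr_ge0 //; last by rewrite oppr_ge0.
  by have := bY x y 0 x1 (ltW y0); lia.
(* Two applications of [t] cancel the signs; iterating gives roots [w x y] with [y] arbitrarily
   large. *)
have step (x y : int) : root (w x y) -> root (w (X (X x y) (Y x y)) (Y (X x y) (Y x y))).
  move=> r; have := root_word_action t (root_word_action t r).
  by rewrite tw word_actionN tw opprK.
have orbit (k : nat) : exists x y : int, [/\ 1 <= x, k%:Z <= y, Q x y <= 0 & root (w x y)].
  elim: k => [|k [x [y [x1 ky hQ r]]]].
    exists 1, 0; split=> //; first by rewrite /Q; nia.
    by rewrite /w scale1r scale0r subr0.
  have y0 : 0 <= y by lia.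
  exists (X (X x y) (Y x y)), (Y (X x y) (Y x y)); split.
  - by apply: (bX); [exact: bX | have := bY x y 0 x1 y0; lia].
  - have h1 := bY x y k%:Z x1 ky; have := bY (X x y) (Y x y) _ (bX _ _ x1 y0) h1; lia.
  - by rewrite !QE.
  - exact: step.
have [s hs] := inversion_finite t.
have [B hB] := seq_bounded s (fun z => `|pairing z cv|).
have [x [y [x1 ky hQ r]]] := orbit B.+1.
have y0 : 0 < y by lia.
have pw (x' y' : int) : pairing (w x' y') cv = - (a' * x' + 2 * y').
  by rewrite pairingB !pairingZ v2 ha; ring.
have X1 := bX x y x1 (ltW y0).
have Y0 := bY x y B.+1%:Z x1 ky.
have rM : root (- w (X x y) (Y x y)) by rewrite -tw; apply: root_word_action.
(* If [- w (X x y) (Y x y)] is nonnegative, it is an inversion; otherwise [mono] forces [w x y] to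
   be nonnegative, and it is one itself. Either pairing with [cv] exceeds [B]. *)
have neg : nonneg_vec (- w (X x y) (Y x y)) -> False.
  move=> h.
  have h' : nonneg_vec (- w (X (X x y) (Y x y)) (Y (X x y) (Y x y))).
    by apply: mono; rewrite ?QE //; lia.
  have : inversion t (- w (X x y) (Y x y)).
    by split=> //; rewrite word_actionN tw opprK.
  case/hs=> /hB + _; rewrite pairingN pw opprK.
  have : 0 <= a' * X x y by rewrite mulr_ge0 //; lia.
  lia.
have [//|pos] := root_sign rM.
rewrite opprK in pos.
have [pu1|/(mono _ _ x1 y0 hQ)] := root_sign r; last exact: neg.
have : inversion t (w x y) by split=> //; rewrite tw opprK.
case/hs=> /hB + _; rewrite pw.
have : 0 <= a' * x by rewrite mulr_ge0 //; lia.
lia.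
Qed.

End Pairs.

(** Replace [v] by [- v]: [pairing_neg_sym] constrains the sign of [u] only. *)
Lemma pairing_pos_sym u v cu cv : coroot_of u cu -> coroot_of v cv ->
  root u -> nonneg_vec u -> 0 < pairing u cv -> 0 < pairing v cu.
Proof.
move=> hu hv ru pu h.
have := pairing_neg_sym hu (coroot_of_opp hv) ru pu.
by rewrite pairingN {1}/pairing mulmxN mxE !oppr_lt0; apply.
Qed.

(** If the product were at least 4, alternating the two reflections would move [u] through
    infinitely many nonnegative combinations of [u] and [v], all of them inversions. *)
Lemma inversion_pairing t u v cu cv : inversion t u -> inversion t v ->
  coroot_of u cu -> coroot_of v cv -> pairing u cv < 0 ->
  pairing v cu < 0 /\ pairing u cv * pairing v cu <= 3.
Proof.
move=> iu iv hu hv ltuv; have [ru pu _] := iu; have [rv pv _] := iv.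
have ltvu := pairing_neg_sym hu hv ru pu ltuv; split=> //.
rewrite leNgt; apply/negP=> ab.
set a : int := - pairing u cv; set b : int := - pairing v cu.
have a0 : 0 < a by rewrite oppr_gt0.
have b0 : 0 < b by rewrite oppr_gt0.
have ha : pairing u cv = - a by rewrite opprK.
have hb : pairing v cu = - b by rewrite opprK.
rewrite ha hb mulrNN in ab.
have u2 := hu.1; have v2 := hv.1.
(* [2 * y < a * x] says that the pairing with [cv] is negative, so reflecting in [v] raises [y]. As
   [4 <= a * b], reflecting in [u] then raises [x] and the inequality persists. *)
have orbit (k : nat) : exists x y : int, [/\ k%:Z <= x, 0 < x, 0 <= y, 2 * y < a * x & root (x *: u + y *: v)].
  elim: k => [|k [x [y [kx x0 y0 hxy r]]]].
    by exists 1, 0; split=> //; rewrite ?scale1r ?scale0r ?addr0 //; lia.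
  set y' : int := a * x - y; set x' : int := b * y' - x.
  have y'y : y < y' by rewrite /y'; lia.
  have hx : 2 * x < b * y'.
    have e : 2 * b * y' = b * (a * x - 2 * y) + a * b * x by rewrite /y'; ring.
    have : 0 < b * (a * x - 2 * y) by rewrite mulr_gt0 //; lia.
    by nia.
  exists x', y'; split; rewrite ?/x'; [lia | lia | lia | |].
    have -> : a * (b * y' - x) = (a * b - 2) * y' + (y' - y) by rewrite /y'; ring.
    by nia.
  have := root_reflection hu (root_reflection hv r).
  rewrite /reflection !(pairingB, pairingN, pairingZ, pairingD) u2 v2 ha hb.
  congr root; apply/rowP=> i; rewrite !row_intE /x' /y'; ring.
have [s hs] := inversion_finite t.
have [i ui] : exists i, 0 < u 0 i.
  apply/existsP; rewrite -[X in is_true X]negbK; apply/negP => /existsPn H.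
  apply: root_neq0; rewrite -(_ : u = 0) //; apply/rowP=> i.
  by move: (H i) (pu i); rewrite row_intE; lia.
have [B hB] := seq_bounded s (fun z => z 0 i).
have [x [y [kx x0 y0 hxy r]]] := orbit B.+1.
have [/hB + _] := hs _ (inversion_comb iu iv (ltW x0) y0 r).
by rewrite !row_intE; have := pv i; nia.
Qed.

(** Of two negative integers with product at most 3 one is -1, so the sum is a reflection of [u] or
    of [v]. *)
Lemma inversion_merge t u v cv : inversion t u -> inversion t v ->
  coroot_of v cv -> pairing u cv < 0 -> inversion t (u + v).
Proof.
move=> iu iv hv lt; have [cu hu] := inversion_coroot iu.
have [lt' le3] := inversion_pairing iu iv hu hv lt.
rewrite -[u]scale1r -[v]scale1r; apply: inversion_comb => //.
have [ru _ _] := iu; have [rv _ _] := iv.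
have [e|e] : pairing u cv = -1 \/ pairing v cu = -1 by nia.
  have := root_reflection hv ru.
  by rewrite /reflection e scaleN1r opprK !scale1r.
have := root_reflection hu rv.
by rewrite /reflection e scaleN1r opprK !scale1r addrC.
Qed.

(* A shortest decomposition will do: terms with negative pairing can be merged. *)
Lemma inversion_decomposition t (l : seq V) :
  (forall v, v \in l -> inversion t v) ->
  exists l', [/\ (l == [::]) = (l' == [::]), \sum_(v <- l') v = \sum_(v <- l) v,
    (forall v, v \in l' -> inversion t v) &
    forall v c, v \in l' -> coroot_of v c -> 2 <= pairing (\sum_(x <- l') x) c].
Proof.
have [k] := ubnP (size l); elim: k l => // k IH l lk hl.
have [H|] := pselect (forall v c, v \in l -> coroot_of v c ->
    forall x, x \in rem v l -> 0 <= pairing x c).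
  exists l; split=> // v c vl hc.
  rewrite (perm_big _ (perm_to_rem vl)) big_cons pairingD hc.1 pairing_sum.
  by rewrite lerDl big_seq sumr_ge0 // => x; exact: H hc x.
move=> /existsNP[v] /existsNP[c] /not_implyP[vl] /not_implyP[hc].
move=> /existsNP[x] /not_implyP[xl] /negP; rewrite -ltNge => lt.
set l1 := x + v :: rem x (rem v l).
have pl : perm_eq l (v :: x :: rem x (rem v l)).
  by rewrite (permPl (perm_to_rem vl)) perm_cons perm_to_rem.
have h1 y : y \in l1 -> inversion t y.
  rewrite inE => /orP[/eqP->|yl].
    by apply: inversion_merge hc lt; apply: hl => //; apply: mem_rem xl.
  by apply: hl; rewrite (mem_rem (mem_rem yl)).
have s1 : (size l1 < k)%N by move: lk; rewrite (perm_size pl) /=; lia.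
have [l' [e1 e2 e3 e4]] := IH l1 s1 h1.
exists l'; split=> //; first by rewrite -e1; case: (l) vl.
by rewrite e2 (perm_big _ pl) /= !big_cons addrA [v + x]addrC.
Qed.

(** A negative pairing has a negative integral partner, and their product is at most 3. *)
Lemma inversion_pairing_ge t u v cv : inversion t u -> inversion t v ->
  coroot_of v cv -> -3 <= pairing u cv.
Proof.
move=> iu iv hv; have [cu hu] := inversion_coroot iu.
have [lt|] := ltP (pairing u cv) 0; last by lia.
by have [] := inversion_pairing iu iv hu hv lt; nia.
Qed.

(** * Congruences modulo 6 and chains of inversions *)

Lemma pairing_congr (m : int) (u v : V) (c : 'cV[int]_n) : (forall i, (m %| u ord0 i - v ord0 i)%Z) ->
  exists k, pairing u c - pairing v c = k * m.
Proof.
move=> h; apply/dvdzP; rewrite -pairingB /pairing mxE.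
apply: rpred_sum => i _; rewrite dvdz_mulr //.
by have := h i; rewrite !row_intE.
Qed.

(** The modulus 6 is the least for which an integer congruent to 2 and at least -3 must be at least
    2. *)
Lemma inversion_sum_incongruent t (u v : V) (l : seq V) :
  inversion t u -> inversion t v -> l != [::] ->
  (forall x, x \in l -> inversion t x) -> v = u + \sum_(x <- l) x ->
  ~ (forall i, (6 %| v ord0 i - u ord0 i)%Z).
Proof.
move=> iu iv l0 hl ev h6.
have [l' [e1 e2 e3 e4]] := inversion_decomposition hl.
have [cv hv] := inversion_coroot iv.
have uv : 2 <= pairing u cv.
  have := inversion_pairing_ge iu iv hv.
  by have [k] := pairing_congr cv h6; rewrite hv.1; lia.
have pos x : x \in l' -> 0 < pairing x cv.
  move=> xl; have ix := e3 x xl; have [cx hx] := inversion_coroot ix.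
  have [rv pv _] := iv.
  (* The sum pairs with [cx] to at least 2 and to a multiple of 6, hence to at least 6, while [u]
     contributes at least -3. *)
  apply: (pairing_pos_sym hv hx rv pv).
  have := inversion_pairing_ge iu ix hx.
  have := e4 x cx xl hx; rewrite e2.
  have [k] := pairing_congr cx h6.
  by rewrite ev pairingD; lia.
(* The sum therefore pairs nonpositively with [cv], against the positivity of each of its terms. *)
have : pairing v cv <= 0 + pairing u cv by rewrite hv.1; lia.
rewrite ev -e2 pairingD addrC lerD2r pairing_sum leNgt => /negP; apply.
case: l' e1 pos {e2 e3 e4} => [|x l'] e1 pos; first by rewrite (negPf l0) in e1.
rewrite big_cons ltr_wpDr ?pos ?mem_head //.
by rewrite big_seq sumr_ge0 // => y yl; rewrite ltW // pos // inE yl orbT.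
Qed.

(** The index counts brackets, so a chain of index [k] has [k + 1] members; the recursion mirrors
    that of [lower_central_series]. *)
Fixpoint inversion_chain t (k : nat) (v : V) : Prop :=
  inversion t v /\
  if k is k'.+1 then
    exists u x, [/\ inversion_chain t k' u, inversion t x & v = x + u]
  else True.

Lemma inversion_chain_seq t k v : inversion_chain t k v ->
  exists g : nat -> V, [/\ g k = v, forall i, (i <= k)%N -> inversion t (g i) &
    forall i, (i < k)%N -> inversion t (g i.+1 - g i)].
Proof.
elim: k v => [|k IH] v /= [iv].
  by move=> _; exists (fun=> v); split=> //.
case=> u [x [/IH[g [gk hg hd]] ix ev]].
exists (fun i => if (i <= k)%N then g i else v); split.
- by rewrite ltnn.
- by move=> i _; case: leqP => [/hg|_].
- move=> i ik; have [lt|ge] := ltnP i k; first by rewrite (ltnW lt); exact: hd.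
  have -> : i = k by lia.
  by rewrite leqnn gk ev addrK.
Qed.

Lemma inversion_chain_bound t v : ~ inversion_chain t (6 ^ n) v.
Proof.
case/inversion_chain_seq=> g [_ hg hd].
(* Pigeonhole: [6 ^ n + 1] members share [6 ^ n] residue vectors. *)
pose col (k : 'I_(6 ^ n).+1) : {ffun 'I_n -> 'I_6} :=
  [ffun i => inord `|(g k ord0 i %% 6)%Z|].
have [/injectiveP inj|] := boolP (injectiveb col).
  have := leq_card _ inj; rewrite card_ord card_ffun !card_ord; lia.
case/injectivePn=> i [j ij ecol].
wlog lt : i j ij ecol / (i < j)%N.
  move=> W; have [/W|/W|e] := ltngtP i j; [exact | | by rewrite (val_inj e) eqxx in ij].
  by apply; rewrite // eq_sym.
have jN : (j <= 6 ^ n)%N by have := ltn_ord j; lia.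
pose l := [seq g k.+1 - g k | k <- index_iota i j].
apply: (@inversion_sum_incongruent t (g i) (g j) l).
- by apply: hg; lia.
- exact: hg.
- by rewrite -size_eq0 size_map size_iota; lia.
- by move=> x /mapP[k]; rewrite mem_index_iota => /andP[_ kj] ->; apply: hd; lia.
- by rewrite big_map telescope_sumr ?(ltnW lt) // addrC subrK.
- move=> k; move/ffunP/(_ k): ecol; rewrite !ffunE => /(congr1 (@nat_of_ord _)).
  (* Residues lie below 6, so [inord] never falls back on its default value. *)
  have m6 z : (`|(z %% 6)%Z| < 6)%N.
    by have := ltz_pmod z (isT : 0 < 6 :> int); have := modz_ge0 z (isT : 6 != 0 :> int); lia.
  rewrite !inordK //; lia.
Qed.

End RealRoots.

(** * Lie algebras and the root lattice *)

Section LieFacts.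
Variables (F : fieldType) (L : lieAlgType F).
Implicit Types (x y z : L) (K S : set L).

HB.instance Definition _ (x : L) :=
  GRing.isLinear.Build F L L *:%R (lie x) (fun a y z => lie_linearr a y z x).

Lemma lieDl x y z : lie (x + y) z = lie x z + lie y z.
Proof. by rewrite -[x in LHS]scale1r lie_linearl scale1r. Qed.

Lemma lie0l z : lie 0 z = 0.
Proof. by apply: (addrI (lie 0 z)); rewrite -lieDl !addr0. Qed.

Lemma lieZl (a : F) x z : lie (a *: x) z = a *: lie x z.
Proof. by rewrite -[a *: x]addr0 lie_linearl lie0l addr0. Qed.

Lemma lieNl x z : lie (- x) z = - lie x z.
Proof. by rewrite -scaleN1r lieZl scaleN1r. Qed.

Lemma lieC x y : lie x y = - lie y x.
Proof.
apply/eqP; rewrite -addr_eq0; apply/eqP.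
have := liexx (x + y); rewrite lieDl !linearD /= !liexx.
by rewrite addr0 add0r.
Qed.

Lemma lie_leibniz x y z : lie x (lie y z) = lie (lie x y) z + lie y (lie x z).
Proof.
have := lie_jacobi x y z; rewrite (lieC z x) (lieC z (lie x y)) linearN /=.
by move=> /eqP; rewrite -addrA -opprD subr_eq0 addrC => /eqP.
Qed.

Lemma lie_lieE x y z : lie (lie x y) z = lie x (lie y z) - lie y (lie x z).
Proof. by rewrite lie_leibniz addrK. Qed.

Section Subspace.
Variables (K : set L) (hK : subspace_set K).

Lemma subspace0 : K 0. Proof. by case: hK. Qed.

Lemma subspaceP (a : F) x y : K x -> K y -> K (a *: x + y).
Proof. by case: hK => _; apply. Qed.

Lemma subspaceD x y : K x -> K y -> K (x + y).
Proof. by move=> hx; rewrite -[x]scale1r; apply: subspaceP. Qed.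

Lemma subspaceZ (a : F) x : K x -> K (a *: x).
Proof. by move=> hx; rewrite -[_ *: _]addr0; apply: subspaceP => //; apply: subspace0. Qed.

Lemma subspaceN x : K x -> K (- x).
Proof. by move=> hx; rewrite -scaleN1r; apply: subspaceZ. Qed.

Lemma subspaceB x y : K x -> K y -> K (x - y).
Proof. by move=> hx /subspaceN; apply: subspaceD. Qed.

End Subspace.

Lemma lin_span_subspace S : subspace_set (lin_span S).
Proof.
split=> [K [hK _]|a x y hx hy K [hK SK]]; first exact: subspace0.
by apply: subspaceP => //; [apply: hx | apply: hy].
Qed.

Lemma lin_span_gen S x : S x -> lin_span S x.
Proof. by move=> Sx K [_]; apply. Qed.

Lemma lin_span_le S K : subspace_set K -> (forall x, S x -> K x) ->
  forall x, lin_span S x -> K x.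
Proof. by move=> hK SK x; apply. Qed.

Lemma lie_preimage_subspace x K : subspace_set K -> subspace_set [set y | K (lie x y)].
Proof.
move=> hK; split=> /=; first by rewrite linear0; exact: subspace0.
by move=> a y z hy hz; rewrite linearP; apply: subspaceP.
Qed.

Lemma lin_span_lie x S K : subspace_set K -> (forall y, S y -> K (lie x y)) ->
  forall y, lin_span S y -> K (lie x y).
Proof. by move=> hK h; apply: lin_span_le (lie_preimage_subspace x hK) h. Qed.

Lemma lin_span_lie2 S T K : subspace_set K ->
  (forall x y, S x -> T y -> K (lie x y)) ->
  forall x y, lin_span S x -> lin_span T y -> K (lie x y).
Proof.
move=> hK h x y hx; apply: lin_span_lie => // {}y Ty.
rewrite lieC; apply: subspaceN => //.
apply: (lin_span_lie hK) hx => x' Sx'.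
by rewrite lieC; apply: subspaceN => //; apply: h.
Qed.

(** By the Jacobi identity; stability of a subspace can thus be tested on generators. *)
Lemma lie_stabilizer_subalgebra K : subspace_set K ->
  lie_subalgebra [set x | forall y, K y -> K (lie x y)].
Proof.
move=> hK; split; first split => /=.
- by move=> y _; rewrite lie0l; apply: subspace0.
- by move=> a x y hx hy z Kz; rewrite lie_linearl; apply: subspaceP; auto.
- move=> x y /= hx hy z Kz; rewrite lie_lieE; apply: subspaceB => //; auto.
Qed.

Lemma generated_induction S K : lie_generated S = setT -> lie_subalgebra K ->
  (forall x, S x -> K x) -> forall x, K x.
Proof. by move=> gS hK SK x; have : setT x by []; rewrite -gS; apply. Qed.

Lemma lie_generated_subalgebra S : lie_subalgebra (lie_generated S).
Proof.
split; first split.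
- by move=> K [[/subspace0]].
- move=> a x y hx hy K [hK SK]; apply: (subspaceP hK.1); [exact: hx | exact: hy].
- by move=> x y hx hy K [hK SK]; apply: hK.2; [exact: hx | exact: hy].
Qed.

(** [lie x] is a derivation; local nilpotency can thus be tested on generators. *)
Lemma lie_nilpotent_subalgebra x :
  lie_subalgebra [set y | exists N, iter N (lie x) y = 0].
Proof.
have mono M N y : iter N (lie x) y = 0 -> iter (M + N) (lie x) y = 0.
  by move=> h; elim: M => [//|M IH] /=; rewrite IH linear0.
have iterP N (a : F) y z : iter N (lie x) (a *: y + z) =
    a *: iter N (lie x) y + iter N (lie x) z.
  by elim: N => [//|N IH]; rewrite !iterS IH linearP.
have iterD N y z : iter N (lie x) (y + z) = iter N (lie x) y + iter N (lie x) z.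
  by have := iterP N 1 y z; rewrite !scale1r.
have it0 N : iter N (lie x) 0 = 0 by rewrite -[N]addn0; apply: mono.
(* By the Leibniz rule, [M + N] applications put at least [M] on [y] or at least [N] on [z]. *)
have brk k : forall M N y z, (M + N <= k)%N -> iter M (lie x) y = 0 ->
    iter N (lie x) z = 0 -> iter k (lie x) (lie y z) = 0.
  elim: k => [|k IH] [|M] [|N] y z le hy hz //;
    try by [rewrite (hy : y = 0) lie0l it0 | rewrite (hz : z = 0) linear0 it0].
  rewrite iterSr lie_leibniz iterD.
  have -> : iter k (lie x) (lie (lie x y) z) = 0.
    by apply: (IH M N.+1) => //; rewrite -hy iterSr.
  rewrite add0r; apply: (IH M.+1 N) => //; [lia | by rewrite -hz iterSr].
split; first split.
- by exists 0%N.
- move=> a y z /= [M hM] [N hN]; exists (M + N)%N.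
  by rewrite iterP (mono M N z hN) addnC (mono N M y hM) scaler0 addr0.
- by move=> y z /= [M hM] [N hN]; exists (M + N)%N; apply: brk hM hN.
Qed.

End LieFacts.

(** * The root lattice inside the dual of the Cartan subalgebra *)

Section Realization.
Variables (n : nat) (A : 'M[int]_n) (F : fieldType) (R : realization A F).
Hypothesis charF0 : [pchar F] =i pred0.
Local Notation H := (cartan R).
Local Notation dual := (dual_space H).
Implicit Types (a b : dual) (v : 'rV[int]_n).

Lemma natr_eq0_pchar0 (k : nat) : (k%:R == 0 :> F) = (k == 0%N).
Proof. exact: (pcharf0P F).1. Qed.

Lemma intr_eq0_pchar0 (k : int) : (k%:~R == 0 :> F) = (k == 0).
Proof. by case: k => k; rewrite ?NegzE ?mulrNz ?oppr_eq0 -pmulrn natr_eq0_pchar0. Qed.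

Definition root_comb v : dual := \sum_(i < n) ((v 0 i)%:~R : F) *: simple_root R i.

Lemma root_combP (k : int) u v :
  root_comb (k *: u + v) = (k%:~R : F) *: root_comb u + root_comb v.
Proof.
rewrite /root_comb scaler_sumr -big_split; apply: eq_bigr => i _ /=.
by rewrite row_intD row_intZ intrD intrM scalerDl scalerA.
Qed.

Lemma root_combD u v : root_comb (u + v) = root_comb u + root_comb v.
Proof. by rewrite -[u in LHS]scale1r root_combP scale1r. Qed.

Lemma root_comb0 : root_comb 0 = 0.
Proof. by apply: (addrI (root_comb 0)); rewrite -root_combD !addr0. Qed.

Lemma root_combZ (k : int) v : root_comb (k *: v) = (k%:~R : F) *: root_comb v.
Proof. by rewrite -[k *: v]addr0 root_combP root_comb0 addr0. Qed.

Lemma root_combN v : root_comb (- v) = - root_comb v.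
Proof. by rewrite -scaleN1r root_combZ scaleN1r. Qed.

Lemma root_comb_simple i : root_comb (simple_vec i) = simple_root R i.
Proof.
rewrite /root_comb (bigD1 i) //= big1 => [|j ji]; first by rewrite mxE !eqxx scale1r addr0.
by rewrite mxE (negPf ji) andbF scale0r.
Qed.

(** Freeness of the simple roots kills the coefficients in [F]; characteristic 0 lifts this to the
    integers. *)
Lemma root_comb_eq0 v : root_comb v = 0 -> v = 0.
Proof.
move=> h; pose X := [tuple simple_root R i | i < n].
have /freeP fX : free X by exact: simple_root_free.
apply/rowP=> i; rewrite mxE; apply/eqP; rewrite -intr_eq0_pchar0; apply/eqP.
apply: (fX (fun i => (v 0 i)%:~R : F)); rewrite -[RHS]h; apply: eq_bigr => j _.
by rewrite -tnth_nth tnth_mktuple.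
Qed.

Lemma root_comb_inj : injective root_comb.
Proof.
move=> u v e; apply/eqP; rewrite -subr_eq0; apply/eqP/root_comb_eq0.
by rewrite root_combD root_combN e subrr.
Qed.

Lemma root_comb_coroot v i :
  (root_comb v (simple_coroot R i) : F) = (pairing v (simple_covec A i))%:~R.
Proof.
rewrite sum_lfunE /pairing mxE rmorph_sum /=; apply: eq_bigr => j _.
by rewrite scale_lfunE root_coroot !mxE rmorphM.
Qed.

Lemma root_comb_refl i v :
  root_comb (simple_refl A i v) = simple_reflection i (root_comb v).
Proof.
by rewrite /simple_refl /reflection root_combD root_combN root_combZ root_comb_simple
  /simple_reflection root_comb_coroot.
Qed.

Definition dual_word_action (t : seq 'I_n) : dual -> dual :=
  foldr (fun i u => simple_reflection i \o u) id t.

Lemma root_comb_word t v :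
  root_comb (word_action A t v) = dual_word_action t (root_comb v).
Proof. by elim: t => [//|i t IH] /=; rewrite root_comb_refl IH. Qed.

End Realization.

(** * Weight spaces, Serre relations and strings *)

Section WeightSpaces.
Variables (n : nat) (A : 'M[int]_n) (F : fieldType) (R : realization A F).
Local Notation H := (cartan R).
Local Notation dual := (dual_space H).
Variables (L : lieAlgType F) (iota : H -> L).
Implicit Types (a b : dual) (x y : L).

Definition weight_space a : set L :=
  [set x | forall h, lie (iota h) x = (a h : F) *: x].

Lemma weight_space_subspace a : subspace_set (weight_space a).
Proof.
split=> [h|k x y hx hy h]; first by rewrite linear0 scaler0.
by rewrite linearP /= hx hy scalerDr !scalerA mulrC.
Qed.

Lemma weight_space_lie a b x y :
  weight_space a x -> weight_space b y -> weight_space (a + b) (lie x y).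
Proof.
move=> hx hy h; rewrite lie_leibniz hx hy lieZl linearZ /=.
by rewrite -scalerDl add_lfunE.
Qed.

Lemma weight_space_iter a b k x y :
  weight_space a x -> weight_space b y -> weight_space (a *+ k + b) (iter k (lie x) y).
Proof.
move=> hx hy; elim: k => [|k IH]; first by rewrite add0r.
by rewrite mulrS -addrA; apply: weight_space_lie.
Qed.

Lemma weight_space_uniq a b x :
  weight_space a x -> weight_space b x -> x != 0 -> a = b.
Proof.
move=> ha hb x0; apply/lfunP => h; apply/eqP; rewrite -subr_eq0.
have := hb h; rewrite ha => /eqP; rewrite -subr_eq0 -scalerBl scaler_eq0.
by rewrite (negPf x0) orbF.
Qed.

Definition weight_sum (P : set dual) : set L :=
  lin_span [set x | exists2 a, P a & weight_space a x].

(* The head term is killed by [lie (iota h) - a h], which only rescales the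
   other weight vectors. *)
Lemma weight_space_independent (P : set dual) b x :
  weight_sum P x -> weight_space b x -> ~ P b -> x = 0.
Proof.
move=> Px bx nPb.
pose K : set L := [set x | exists l : seq L,
  (forall y, y \in l -> exists2 a, P a & weight_space a y) /\ x = \sum_(y <- l) y].
have [l [hl ex]] : K x.
  apply: (lin_span_le _ _ Px) => {x Px bx}; first split.
  - by exists [::]; rewrite big_nil.
  - move=> k x y [l [hl ->]] [l' [hl' ->]].
    exists ([seq k *: z | z <- l] ++ l'); split; last first.
      by rewrite big_cat big_map scaler_sumr.
    move=> z; rewrite mem_cat => /orP[/mapP[z' /hl[a Pa hz'] ->]|/hl' //].
    by exists a => //; apply: (subspaceZ (weight_space_subspace a)).
  - by move=> x hx; exists [:: x]; rewrite big_seq1; split=> // y; rewrite inE => /eqP->.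
suff: forall l, (forall y, y \in l -> exists2 a, P a & weight_space a y) ->
    weight_space b (\sum_(y <- l) y) -> \sum_(y <- l) y = 0.
  by rewrite ex => -> //; rewrite -ex.
move=> {K Px bx hl ex} {}l; have [k] := ubnP (size l).
elim: k l => // k IH [|y l] lk hl bs; first by rewrite big_nil.
have [a Pa ay] := hl y (mem_head y l).
have [h abh] : exists h, b h - a h != 0 :> F.
  apply: contrapT => /forallNP H; apply: nPb; rewrite (_ : b = a) //.
  by apply/lfunP => h; apply/eqP; rewrite -subr_eq0; apply: contrapT => /negP /H.
pose D z := lie (iota h) z - (a h : F) *: z.
have DD : D (\sum_(z <- y :: l) z) = \sum_(z <- [seq D z | z <- l]) z.
  rewrite big_map /D linear_sum scaler_sumr -sumrB big_cons.
  by rewrite /= ay subrr add0r.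
have DE : D (\sum_(z <- y :: l) z) = (b h - a h : F) *: \sum_(z <- y :: l) z.
  by rewrite /D bs scalerBl.
apply/eqP; have : D (\sum_(z <- y :: l) z) == 0.
  rewrite DD; apply/eqP; apply: IH; first by rewrite size_map.
    move=> _ /mapP[z zl ->]; have [|c Pc cz] := hl z; first by rewrite inE zl orbT.
    exists c => //; rewrite /D cz -scalerBl.
    exact: (subspaceZ (weight_space_subspace c)).
  by rewrite -DD DE; exact: (subspaceZ (weight_space_subspace b)).
by rewrite DE scaler_eq0 (negPf abh).
Qed.

End WeightSpaces.

(** * Algebras with Chevalley generators *)

Section CartanGenerated.
Variables (n : nat) (A : 'M[int]_n) (F : fieldType) (R : realization A F).
Hypothesis hA : generalized_cartan_matrix A.
Hypothesis charF0 : [pchar F] =i pred0.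
Local Notation H := (cartan R).
Local Notation dual := (dual_space H).
Local Notation V := 'rV[int]_n.
Local Notation phi := (root_comb R).

(** Stated for arbitrary generators so that every result also applies after exchanging [e] and
    [f]. *)
Record cartan_generated (L : lieAlgType F) (e f : 'I_n -> L) (iota : H -> L) : Prop := {
  cg_relations : chevalley_relations e f iota;
  cg_generated : lie_generated (range e `|` range f `|` range iota) = setT;
  cg_ideal : forall K, lie_ideal K -> trivial_on_cartan iota K -> K `<=` [set 0]
}.

Section Generation.
Variables (L : lieAlgType F) (e f : 'I_n -> L) (iota : H -> L).
Hypothesis hL : cartan_generated e f iota.
Let rel := cg_relations hL.

Lemma iota0 : iota 0 = 0.
Proof.
apply: (addrI (iota 0)); rewrite addr0 -[X in X + _]scale1r -(iota_linear rel).
by rewrite scaler0 addr0.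
Qed.

Lemma iotaN h : iota (- h) = - iota h.
Proof. by rewrite -scaleN1r -[_ *: h]addr0 (iota_linear rel) iota0 addr0 scaleN1r. Qed.

(* The Chevalley involution: it exchanges [e] with [f], and [weight_space a]
   with [weight_space (- a)]. *)
Lemma cartan_generated_swap : cartan_generated f e (fun h => - iota h).
Proof.
split.
- split.
  + by move=> a h h'; rewrite (iota_linear rel) opprD scalerN.
  + move=> i j; rewrite lieC (lie_ef rel) eq_sym; case: eqP => [->//|_].
    by rewrite oppr0.
  + by move=> h h'; rewrite lieNl linearN /= (lie_hh rel) !oppr0.
  + by move=> h i; rewrite lieNl (lie_hf rel) opprK.
  + by move=> h i; rewrite lieNl (lie_he rel).
- apply/seteqP; split=> // x _; have hS := lie_generated_subalgebra.
  apply: (generated_induction (cg_generated hL) (hS _ _ _)) => y.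
  case=> [[|]|] [i _ <-].
  + by move=> K [_]; apply; left; right; exists i.
  + by move=> K [_]; apply; left; left; exists i.
  + move=> K [[hK _] SK]; rewrite -[iota i]opprK; apply: subspaceN => //.
    by apply: SK; right; exists i.
- move=> K hK tK; apply: (cg_ideal hL) => // x [Kx [h _ hx]]; apply: tK; split=> //.
  by exists (- h) => //; rewrite iotaN opprK.
Qed.

Lemma weight_space_swap a x :
  weight_space iota a x -> weight_space (fun h => - iota h) (- a) x.
Proof. by move=> hx h; rewrite lieNl hx opp_lfunE scaleNr. Qed.

Lemma weight_space_e i : weight_space iota (simple_root R i) (e i).
Proof. by move=> h; rewrite (lie_he rel). Qed.

Lemma weight_space_f i : weight_space iota (- simple_root R i) (f i).
Proof. by move=> h; rewrite (lie_hf rel) opp_lfunE scaleNr. Qed.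

Lemma weight_space_iota h : weight_space iota 0 (iota h).
Proof. by move=> h'; rewrite (lie_hh rel) zero_lfunE scale0r. Qed.

Lemma generators_stable (K : set L) : subspace_set K ->
  (forall i y, K y -> K (lie (e i) y)) -> (forall i y, K y -> K (lie (f i) y)) ->
  (forall h y, K y -> K (lie (iota h) y)) -> forall x y, K y -> K (lie x y).
Proof.
move=> hK he hf hh; apply: (generated_induction (cg_generated hL)).
  exact: lie_stabilizer_subalgebra.
by move=> _ [[|]|] [i _ <-] /=; [exact: he | exact: hf | exact: hh].
Qed.

Definition lie_word (x : 'I_n -> L) (u : seq 'I_n) (y : L) : L :=
  foldr (fun i => lie (x i)) y u.

Definition word_content (u : seq 'I_n) : V := \sum_(i <- u) simple_vec i.

Lemma word_contentE u i : word_content u 0 i = (count_mem i u)%:Z.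
Proof.
rewrite /word_content; elim: u => [|j u IH]; first by rewrite big_nil row_int0.
by rewrite big_cons row_intD IH mxE eqxx /= PoszD [j == i]eq_sym; case: (i == j).
Qed.

Lemma weight_space_word_e u a y : weight_space iota a y ->
  weight_space iota (phi (word_content u) + a) (lie_word e u y).
Proof.
move=> hy; elim: u => [|i u IH] /=; first by rewrite /word_content big_nil root_comb0 add0r.
rewrite /word_content big_cons root_combD root_comb_simple -addrA.
by apply: weight_space_lie => //; exact: weight_space_e.
Qed.

(** Moving [f k] to the right past an [e i] leaves at most a Cartan element, which acts on the
    remaining word by a scalar. *)
Lemma lie_f_word_e k u a y : weight_space iota a y -> (forall i, lie (f i) y = 0) ->
  lin_span [set lie_word e v y | v in setT] (lie (f k) (lie_word e u y)).
Proof.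
move=> hy hf; set S := [set _ | _ in _]; have hS := lin_span_subspace S.
elim: u => [|i u IH] /=; first by rewrite hf; apply: (subspace0 hS).
rewrite lie_leibniz (lieC (f k)) (lie_ef rel); apply: (subspaceD hS).
  rewrite lieNl; apply: (subspaceN hS); case: eqP => _; last first.
    by rewrite lie0l; apply: (subspace0 hS).
  rewrite (weight_space_word_e u hy); apply: (subspaceZ hS).
  by apply: lin_span_gen; exists u.
apply: (lin_span_lie hS) IH.
by move=> _ [v _ <-]; apply: lin_span_gen; exists (i :: v).
Qed.

(* The ideal generated by [y] is spanned by the words in the [e i] applied to
   [y], hence meets the Cartan subalgebra trivially. *)
Lemma f_annihilated_eq0 c y : nonneg_vec c -> c != 0 ->
  weight_space iota (phi c) y -> (forall i, lie (f i) y = 0) -> y = 0.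
Proof.
move=> c0 cn0 hy hf.
pose S : set L := [set lie_word e u y | u in setT].
have hS := lin_span_subspace S.
have yS : lin_span S y by apply: lin_span_gen; exists [::].
suff : lin_span S `<=` [set 0] by apply.
apply: (cg_ideal hL).
  split=> //; apply: generators_stable => // i z; apply: (lin_span_lie hS) => _ [u _ <-].
  - by apply: lin_span_gen; exists (i :: u).
  - exact: (lie_f_word_e i u hy hf).
  - rewrite (weight_space_word_e u hy); apply: (subspaceZ hS).
    by apply: lin_span_gen; exists u.
move=> x [hS0 [h _ ex]]; subst x.
(* Words on [y] have weights [phi (word_content u + c)], nonzero because [c] is nonnegative and
   nonzero. *)
pose P : set dual := [set b | exists u, b = phi (word_content u + c)].
apply: (@weight_space_independent _ _ _ _ _ iota P 0).
- apply: lin_span_le hS0; first exact: lin_span_subspace.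
  move=> _ [u _ <-]; apply: lin_span_gen; exists (phi (word_content u + c)).
    by exists u.
  by rewrite root_combD; apply: weight_space_word_e.
- exact: weight_space_iota.
- move=> [u /esym/(root_comb_eq0 charF0) e0]; move/eqP: cn0; apply.
  apply/rowP => i; move/rowP/(_ i): e0; rewrite row_intD word_contentE !row_int0.
  by have := c0 i; move: (c 0 i) (count_mem i u) => z m; lia.
Qed.

(** The sl2 commutation rule for [e i], [f i] and their coroot. *)
Lemma lie_e_iter_f i k a x : weight_space iota a x ->
  lie (e i) (iter k.+1 (lie (f i)) x) = iter k.+1 (lie (f i)) (lie (e i) x)
    + (k.+1%:R * ((a (simple_coroot R i) : F) - k%:R)) *: iter k (lie (f i)) x.
Proof.
case: hA => A2 _ _ hx; elim: k => [|k IH].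
  by rewrite /= lie_leibniz (lie_ef rel) eqxx hx subr0 mul1r addrC.
rewrite iterS lie_leibniz IH (lie_ef rel) eqxx linearD linearZ /=.
have /(_ (simple_coroot R i)) := weight_space_iter k.+1 (weight_space_f i) hx.
rewrite /= => ->; rewrite addrCA -scalerDl; congr (_ + _ *: _).
rewrite add_lfunE -scaler_nat scale_lfunE opp_lfunE root_coroot A2.
by rewrite -[_ *: _]/(_ * _); ring.
Qed.

End Generation.

(** The Serre element is killed by every [e k], so [f_annihilated_eq0] applies after the swap. For
    [k = i] the exponent [1 - A i j] makes the scalar of [lie_e_iter_f] vanish. *)
Lemma serre_f L e f iota (hL : @cartan_generated L e f iota) i j : i != j ->
  iter `|A i j|.+1 (lie (f i)) (f j) = 0.
Proof.
move=> ij; case: hA => A2 A0 Asym; have rel := cg_relations hL.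
set p := `|A i j|%N.
have Ap : A i j = - p%:Z by have := A0 i j ij; rewrite /p; lia.
pose c : V := (p.+1)%:Z *: simple_vec i + simple_vec j.
have wt := weight_space_iter p.+1 (weight_space_f hL i) (weight_space_f hL j).
apply: (f_annihilated_eq0 (cartan_generated_swap hL) (c := c)).
- by move=> k; rewrite row_intD row_intZ !mxE; lia.
- apply/eqP => /rowP/(_ i); rewrite row_intD row_intZ row_int0 !mxE !eqxx (negPf ij); lia.
- move/weight_space_swap: wt; rewrite opprD mulNrn !opprK root_combD root_combZ.
  by rewrite !root_comb_simple -scaler_nat -pmulrn.
move=> k; have [->|ki] := eqVneq k i.
  rewrite (lie_e_iter_f hL _ _ (weight_space_f hL j)) (lie_ef rel) (negPf ij).
  rewrite opp_lfunE root_coroot Ap mulrNz opprK -pmulrn subrr mulr0 scale0r addr0.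
  by elim: (p.+1) => [//|m IH]; rewrite iterS IH linear0.
have ef m x : lie (e k) (iter m (lie (f i)) x) = iter m (lie (f i)) (lie (e k) x).
  elim: m => [//|m IH]; rewrite !iterS lie_leibniz (lie_ef rel) (negPf ki) lie0l.
  by rewrite add0r IH.
rewrite ef (lie_ef rel); have [->|kj] := eqVneq k j; last first.
  by elim: (p.+1) => [//|m IH]; rewrite iterS IH linear0.
(* For [k = j], the bracket of [f i] with the coroot is [A j i] times [f i]: a further [f i] kills
   it, and if [p = 0] then [A j i = 0]. *)
rewrite iterSr [lie (f i) _]lieC (lie_hf rel) opprK root_coroot.
case: (posnP p) => [p0|p1].
  have -> : A j i = 0 by apply/(Asym i j); rewrite Ap p0.
  by rewrite scale0r p0.
rewrite -(prednK p1) iterSr linearZ /= liexx scaler0.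
by elim: (p.-1) => [//|m IH]; rewrite iterS IH linear0.
Qed.

Lemma locally_nilpotent_f L e f iota (hL : @cartan_generated L e f iota) i x :
  exists N, iter N (lie (f i)) x = 0.
Proof.
have rel := cg_relations hL.
apply: (generated_induction (cg_generated hL) (lie_nilpotent_subalgebra (f i))).
move=> _ [[|]|] [j _ <-] /=.
- have hf : lie (f i) (e j) = - (if j == i then iota (simple_coroot R j) else 0).
    by rewrite lieC (lie_ef rel).
  exists 3%N; rewrite !iterS hf; case: eqP => _; last by rewrite oppr0 !linear0.
  by rewrite !linearN /= (lieC (f i) (iota _)) (lie_hf rel) opprK linearZ /= liexx scaler0 oppr0.
- have [->|ij] := eqVneq i j; first by exists 1%N; rewrite /= liexx.
  by exists `|A i j|%N.+1; exact: (serre_f hL).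
- by exists 2%N; rewrite /= (lieC (f i) (iota _)) (lie_hf rel) opprK linearZ /= liexx scaler0.
Qed.

(* The string through [x] is followed downwards; the induction is on the
   order of nilpotency of [lie (e i)] on [x]. *)
Lemma iter_f_eq0 L e f iota (hL : @cartan_generated L e f iota) i a (p : nat) x :
  weight_space iota a x -> (a (simple_coroot R i) : F) = p%:R ->
  iter p (lie (f i)) x = 0 -> x = 0.
Proof.
have [N] := locally_nilpotent_f (cartan_generated_swap hL) i x.
elim: N a p x => [//|N IH] a p x eN hx hp fp.
have fup k : iter (k + p) (lie (f i)) x = 0.
  by elim: k => [//|k IHk]; rewrite addSn iterS IHk linear0.
(* Raising by [e i] adds 2 to the weight, and [lie_e_iter_f] shows that [p + 2] applications of
   [f i] kill the raised vector. *)
have ex0 : lie (e i) x = 0.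
  apply: (IH (simple_root R i + a) p.+2); first by rewrite -iterSr.
  - by apply: weight_space_lie => //; exact: (weight_space_e hL).
  - by case: hA => A2 _ _; rewrite add_lfunE root_coroot A2 hp -[p.+2]/(2 + p)%N natrD.
  - have := lie_e_iter_f hL i p.+1 hx.
    rewrite -[p.+2]/(2 + p)%N (fup 2) linear0 -[p.+1]/(1 + p)%N (fup 1).
    by rewrite scaler0 addr0 => <-.
(* Since [e i] kills [x], the rule reads [(k + 1) * (p - k)] times the [k]-th iterate is 0; in
   characteristic 0 vanishing descends from [p] to 0. *)
have fdown k : (k <= p)%N -> iter k (lie (f i)) x = 0.
  move=> kp; rewrite -(subKn kp); move: (p - k)%N (leq_subr k p) => {kp}k.
  elim: k => [|k IHk] kp; first by rewrite subn0.
  have := lie_e_iter_f hL i (p - k.+1) hx.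
  have e1 : ((p - k.+1).+1 = p - k)%N by lia.
  rewrite e1 IHk ?linear0; last by lia.
  rewrite ex0 (_ : iter _ _ 0 = 0) ?add0r; last first.
    by elim: (p - k)%N => [//|m IHm]; rewrite iterS IHm linear0.
  move=> /esym/eqP; rewrite scaler_eq0 hp -natrB; last by lia.
  by rewrite -natrM (natr_eq0_pchar0 charF0) muln_eq0 => /orP[|/eqP //]; lia.
exact: (fdown 0%N).
Qed.

End CartanGenerated.

(** * The roots of a Kac-Moody algebra *)

Section Roots.
Variables (n : nat) (A : 'M[int]_n) (F : fieldType) (R : realization A F).
Hypothesis hA : generalized_cartan_matrix A.
Hypothesis charF0 : [pchar F] =i pred0.
Local Notation H := (cartan R).
Local Notation dual := (dual_space H).
Local Notation V := 'rV[int]_n.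
Local Notation phi := (root_comb R).

Definition lie_words (L : lieAlgType F) (x : 'I_n -> L) : set L :=
  [set y | exists u j, y = lie_word x u (x j)].

Lemma lie_e_word_f (L : lieAlgType F) (e f : 'I_n -> L) (iota : H -> L)
    (hL : cartan_generated e f iota) i u j :
  lin_span (range iota `|` lie_words f) (lie (e i) (lie_word f u (f j))).
Proof.
have rel := cg_relations hL; set S := _ `|` _; have hS := lin_span_subspace S.
elim: u => [|k u IH] /=.
  rewrite (lie_ef rel); case: eqP => _; last exact: (subspace0 hS).
  by apply: lin_span_gen; left; exists (simple_coroot R i).
rewrite lie_leibniz (lie_ef rel); apply: (subspaceD hS).
  case: eqP => _; last by rewrite lie0l; exact: (subspace0 hS).
  have hsw := cartan_generated_swap hL.
  have := weight_space_word_e hsw u (weight_space_e hsw j).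
  move/(_ (simple_coroot R i)); rewrite lieNl => /eqP; rewrite eqr_oppLR => /eqP ->.
  apply: (subspaceN hS); apply: (subspaceZ hS); apply: lin_span_gen; right.
  by exists u, j.
apply: (lin_span_lie hS) IH => _ [[h _ <-]|[v [l ->]]].
  rewrite lieC (lie_hf rel) opprK; apply: (subspaceZ hS).
  by apply: lin_span_gen; right; exists [::], k.
by apply: lin_span_gen; right; exists (k :: v), l.
Qed.

Section Decomposition.
Variables (L : lieAlgType F) (e f : 'I_n -> L) (iota : H -> L).
Hypothesis hL : cartan_generated e f iota.
Let rel := cg_relations hL.
Let hsw := cartan_generated_swap hL.

Definition triangular_gens : set L := range iota `|` lie_words e `|` lie_words f.

(** The span contains the generators and is stable under them, hence is everything. *)
Lemma triangular_decomposition x : lin_span triangular_gens x.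
Proof.
set S := triangular_gens; have hS := lin_span_subspace S.
have Se i : S (e i) by left; right; exists [::], i.
have Sf i : S (f i) by right; exists [::], i.
have Sh h : S (iota h) by left; left; exists h.
have stab : forall x y, lin_span S y -> lin_span S (lie x y).
  apply: (generators_stable hL hS) => [i y|i y|h y]; apply: (lin_span_lie hS) => {y} y.
  - case=> [[[h _ <-]|[u [j ->]]]|[u [j ->]]].
    + rewrite lieC (lie_he rel); apply: (subspaceN hS); apply: (subspaceZ hS).
      exact: lin_span_gen.
    + by apply: lin_span_gen; left; right; exists (i :: u), j.
    + apply: (lin_span_le hS _ (lie_e_word_f hL i u j)) => z [[h _ <-]|hz].
        exact: lin_span_gen.
      by apply: lin_span_gen; right.
  - case=> [[[h _ <-]|[u [j ->]]]|[u [j ->]]].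
    + rewrite lieC (lie_hf rel) opprK; apply: (subspaceZ hS); exact: lin_span_gen.
    + apply: (lin_span_le hS _ (lie_e_word_f hsw i u j)) => z [[h _ <-]|hz].
        by apply: (subspaceN hS); exact: lin_span_gen.
      by apply: lin_span_gen; left; right.
    + by apply: lin_span_gen; right; exists (i :: u), j.
  - move=> Sy; case: (Sy) => [[[h' _ <-]|[u [j ey]]]|[u [j ey]]].
    + by rewrite (lie_hh rel); exact: (subspace0 hS).
    + have := weight_space_word_e hL u (weight_space_e hL j).
      move/(_ h); rewrite -ey => ->; apply: (subspaceZ hS); exact: lin_span_gen.
    + have := weight_space_word_e hsw u (weight_space_e hsw j).
      move/(_ h); rewrite lieNl -ey => /eqP; rewrite eqr_oppLR => /eqP ->.
      by apply: (subspaceN hS); apply: (subspaceZ hS); exact: lin_span_gen.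
apply: (generated_induction (cg_generated hL)) x; first by split=> //; auto.
by move=> _ [[|]|] [i _ <-]; apply: lin_span_gen.
Qed.

Definition weight_root (a : dual) : Prop :=
  a != 0 /\ exists x, weight_space iota a x /\ x != 0.

(** By independence of weight spaces, a root is the weight of a nonzero triangular generator, and
    not of a Cartan element since it is nonzero. *)
Lemma weight_root_word a : weight_root a ->
  (exists u j, a = phi (word_content (j :: u)) /\ lie_word e u (e j) != 0) \/
  (exists u j, a = - phi (word_content (j :: u))).
Proof.
case=> a0 [x [ax x0]].
pose P : set dual := [set b | exists2 y, triangular_gens y & weight_space iota b y /\ y != 0].
have contE u j : phi (word_content (j :: u)) = phi (word_content u) + simple_root R j.
  by rewrite /word_content big_cons root_combD root_comb_simple addrC.
have we u j := weight_space_word_e hL u (weight_space_e hL j).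
have wf u j : weight_space iota (- phi (word_content (j :: u))) (lie_word f u (f j)).
  have := weight_space_word_e hsw u (weight_space_e hsw j).
  by move/weight_space_swap; rewrite contE => h k; have := h k; rewrite opprK.
have : P a.
  apply: contrapT => nPa; move/eqP: x0; apply.
  apply: (weight_space_independent (P := P) _ ax nPa).
  have hS := lin_span_subspace (F := F) (L := L).
  apply: (lin_span_le (hS _) _ (triangular_decomposition x)) => y Gy.
  have [->|y0] := eqVneq y 0; first exact: (subspace0 (hS _)).
  have [b hb] : exists b, weight_space iota b y.
    case: Gy => [[[h _ <-]|[u [j ->]]]|[u [j ->]]].
    - by exists 0; exact: (weight_space_iota hL).
    - by exists (phi (word_content u) + simple_root R j).
    - by exists (- phi (word_content (j :: u))).
  by apply: lin_span_gen; exists b => //; exists y.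
case=> y Gy [ay y0]; case: Gy ay y0 => [[[h _ <-]|[u [j ->]]]|[u [j ->]]] ay y0.
- by move/eqP: a0 => []; apply: (weight_space_uniq ay (weight_space_iota hL h) y0).
- by left; exists u, j; rewrite contE; split=> //; apply: weight_space_uniq ay (we u j) y0.
- by right; exists u, j; apply: weight_space_uniq ay (wf u j) y0.
Qed.

Lemma word_content_ge0 u : nonneg_vec (word_content (n := n) u).
Proof. by move=> i; rewrite word_contentE. Qed.

Lemma weight_root_sign v : weight_root (phi v) -> nonneg_vec v \/ nonneg_vec (- v).
Proof.
case/weight_root_word=> [[u [j [/(root_comb_inj charF0)-> _]]]|[u [j]]].
  by left; exact: word_content_ge0.
rewrite -root_combN => /(root_comb_inj charF0)->; right; rewrite opprK.
exact: word_content_ge0.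
Qed.

(** A word of length at least 2 in [e i] alone vanishes, as it contains [lie (e i) (e i)]. *)
Lemma weight_root_multiple i v : weight_root (phi v) -> nonneg_vec v ->
  (forall j, j != i -> v 0 j = 0) -> v = simple_vec i.
Proof.
case/weight_root_word=> [[u [j [/(root_comb_inj charF0)-> wn0]]]|[u [j]]]; last first.
  rewrite -root_combN => /(root_comb_inj charF0)-> /(_ j).
  by rewrite row_intN word_contentE /= eqxx; lia.
move=> _ supp.
have all_i : all (pred1 i) (j :: u).
  apply/allP => k kin; apply/eqP; apply: contraTeq kin => /supp.
  by rewrite word_contentE => -[c0]; apply/count_memPn.
move: all_i wn0 => /= /andP[/eqP-> ui].
case: u ui {supp} => [_ _|k u ui]; first by rewrite /word_content big_seq1.
case/eqP; elim: u k ui => [|l u IH] k /= /andP[/eqP -> ui]; first exact: liexx.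
by have /= -> := IH l ui; rewrite linear0.
Qed.

End Decomposition.

Lemma weight_root_swap (L : lieAlgType F) (iota : H -> L) a :
  weight_root iota a -> weight_root (fun h => - iota h) (- a).
Proof.
case=> a0 [x [ax x0]]; split; first by rewrite oppr_eq0.
by exists x; split=> //; exact: weight_space_swap.
Qed.

(** Applying [f i] to a root vector [pairing v (simple_covec A i)] times gives the reflected weight,
    and the result is nonzero by [iter_f_eq0]. *)
Lemma weight_root_refl_pos (L : lieAlgType F) (e f : 'I_n -> L) (iota : H -> L)
    (hL : cartan_generated e f iota) i v :
  weight_root iota (phi v) -> 0 <= pairing v (simple_covec A i) ->
  weight_root iota (phi (simple_refl A i v)).
Proof.
move=> [v0 [x [vx x0]]] p0; set p := pairing v _ in p0 *.
have [A2 _ _] := hA.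
have ep : p = `|p|%N :> int by lia.
split.
  apply/eqP => /(root_comb_eq0 charF0) sv0; move/eqP: v0; apply.
  by rewrite -(simple_reflK A2 i v) sv0 /simple_refl /reflection /pairing mul0mx mxE scale0r subr0 root_comb0.
exists (iter `|p|%N (lie (f i)) x); split.
  have := weight_space_iter `|p|%N (weight_space_f hL i) vx.
  rewrite /simple_refl /reflection -/p root_combD root_combN root_combZ root_comb_simple.
  by rewrite [in X in _ -> X]ep -pmulrn scaler_nat mulNrn addrC.
apply/eqP => fx0; move/eqP: x0; apply; apply: (iter_f_eq0 hA charF0 hL vx) fx0.
by rewrite root_comb_coroot -/p [in LHS]ep.
Qed.

Lemma weight_root_refl (L : lieAlgType F) (e f : 'I_n -> L) (iota : H -> L)
    (hL : cartan_generated e f iota) i v :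
  weight_root iota (phi v) -> weight_root iota (phi (simple_refl A i v)).
Proof.
move=> hv; have [p0|p0] := leP 0 (pairing v (simple_covec A i)).
  exact: (weight_root_refl_pos hL).
have hsw := cartan_generated_swap hL.
have := weight_root_swap hv; rewrite -root_combN => hv'.
have := weight_root_refl_pos hsw (i := i) hv'; rewrite pairingN oppr_ge0 => /(_ (ltW p0)).
move/weight_root_swap; rewrite -root_combN /simple_refl /reflection pairingN scaleNr.
rewrite opprD !opprK => -[h0 [x [hx x0]]]; split=> //; exists x; split=> // h.
by have := hx h; rewrite opprK.
Qed.

End Roots.

(** * The inversion subalgebra *)

Section InversionSubalgebra.
Variables (n : nat) (A : 'M[int]_n) (F : fieldType) (R : realization A F).
Hypothesis hA : generalized_cartan_matrix A.
Hypothesis charF0 : [pchar F] =i pred0.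
Variable g : kac_moody_algebra R.
Local Notation H := (cartan R).
Local Notation dual := (dual_space H).
Local Notation V := 'rV[int]_n.
Local Notation phi := (root_comb R).

Lemma km_cartan_generated : cartan_generated (@km_e _ _ _ _ g) (@km_f _ _ _ _ g) (@km_cartan _ _ _ _ g).
Proof.
have [L [e [f [iota [pi [pres [[piP piL] surj] [idJ trJ maxJ] [/funext-> /funext-> /funext->]]]]]]] :=
  km_quotient g.
have rel := presented_relations pres.
have pi0 : pi 0 = 0.
  by apply: (addrI (pi 0)); rewrite addr0 -[X in X + _]scale1r -piP scaler0 addr0.
have piZ a x : pi (a *: x) = a *: pi x by rewrite -[a *: x]addr0 piP pi0 addr0.
have piN x : pi (- x) = - pi x by rewrite -scaleN1r piZ scaleN1r.
have onto y : exists x, pi x = y.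
  have : range pi y by rewrite surj.
  by case=> x _ <-; exists x.
split.
- split.
  + by move=> a h h'; rewrite (iota_linear rel) piP.
  + by move=> i j; rewrite -piL (lie_ef rel); case: eqP.
  + by move=> h h'; rewrite -piL (lie_hh rel).
  + by move=> h i; rewrite -piL (lie_he rel) piZ.
  + by move=> h i; rewrite -piL (lie_hf rel) piN piZ.
- apply/seteqP; split=> // y _ K [[hK lK] SK]; have [x <-] := onto y.
  apply: (generated_induction (K := pi @^-1` K) (presented_generated pres)).
    split; first split=> /= [|a x1 x2 h1 h2]; first by rewrite pi0; exact: (subspace0 hK).
      by rewrite piP; exact: (subspaceP hK).
    by move=> x1 x2 h1 h2 /=; rewrite piL; exact: lK.
  move=> _ [[|]|] [i _ <-]; apply: SK; by [left; left; exists i | left; right; exists i | right; exists i].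
- move=> K [hK iK] tK y Ky; have [x ex] := onto y.
  have : [set z | pi z = 0] x.
    (* The preimage of [K] is an ideal; its Cartan elements map to 0 by [tK], hence vanish by
       [trJ]. *)
    apply: (maxJ (pi @^-1` K)); last by rewrite /= ex.
      split=> /= [|x1 x2 h2]; last by rewrite piL; exact: iK.
      split=> /= [|a x1 x2 h1 h2]; first by rewrite pi0; exact: (subspace0 hK).
      by rewrite piP; exact: (subspaceP hK).
    move=> z [/= Kz [h _ ez]]; apply: trJ; split=> /=; last by exists h.
    by apply: tK; split=> //; exists h => //; rewrite ez.
  by rewrite /= ex.
Qed.

Lemma simple_reflectionK i : involutive (@simple_reflection _ _ _ R i).
Proof.
move=> a; rewrite /simple_reflection add_lfunE opp_lfunE scale_lfunE root_coroot.
case: hA => -> _ _; rewrite -[_ *: _%:~R]/(_ * _) -addrA -opprD -scalerDl.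
rewrite [X in X *: _](_ : _ = 0) ?scale0r ?subr0 //; ring.
Qed.

Lemma dual_word_action_cat t1 t2 (a : dual) :
  dual_word_action (t1 ++ t2) a = dual_word_action t1 (dual_word_action t2 a).
Proof. by elim: t1 => [//|i t1 IH] /=; rewrite IH. Qed.

Lemma dual_word_actionK t (a : dual) : dual_word_action (rev t) (dual_word_action t a) = a.
Proof.
elim: t a => [//|i t IH] a.
by rewrite rev_cons -cats1 dual_word_action_cat /= simple_reflectionK IH.
Qed.

Lemma weyl_group_word (w : dual -> dual) : weyl_group w ->
  exists t, forall a, w a = dual_word_action t a.
Proof.
elim=> [|i|u v _ [t1 h1] _ [t2 h2]|u v _ [t ht] uv vu].
- by exists [::].
- by exists [:: i].
- by exists (t1 ++ t2) => a; rewrite dual_word_action_cat -h2 -h1.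
- by exists (rev t) => a; rewrite -[a in RHS]vu ht dual_word_actionK.
Qed.

Definition root_vec (v : V) : Prop := km_root g (phi v).

Lemma root_vec_neq0 : ~ root_vec 0.
Proof. by case; rewrite root_comb0 eqxx. Qed.

Lemma root_vec_sign v : root_vec v -> nonneg_vec v \/ nonneg_vec (- v).
Proof. exact: (weight_root_sign charF0 km_cartan_generated). Qed.

Lemma root_vec_refl i v : root_vec v -> root_vec (simple_refl A i v).
Proof. exact: (weight_root_refl hA charF0 km_cartan_generated). Qed.

Lemma root_vec_multiple i v : root_vec v -> nonneg_vec v ->
  (forall j, j != i -> v 0 j = 0) -> v = simple_vec i.
Proof. exact: (weight_root_multiple charF0 km_cartan_generated). Qed.

Lemma root_comb_nat (c : 'I_n -> nat) :
  \sum_(i < n) simple_root R i *+ c i = phi (\row_i (c i)%:Z).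
Proof. by apply: eq_bigr => i _; rewrite mxE -pmulrn scaler_nat. Qed.

Lemma nonneg_vecE (v : V) : nonneg_vec v -> v = \row_i (`|v 0%R i|%N)%:Z.
Proof. by move=> v0; apply/rowP => i; rewrite mxE; have := v0 i; lia. Qed.

Lemma inversion_setE (w : dual -> dual) t : (forall a, w a = dual_word_action t a) ->
  forall a, inversion_set g w a <-> exists2 v, a = phi v & inversion A root_vec t v.
Proof.
move=> hw a; split.
  case=> [[ra [c ea]] [_ [d]]]; move: ra; rewrite {a}ea hw !root_comb_nat.
  rewrite -root_comb_word -root_combN => rc /(root_comb_inj charF0) ed.
  exists (\row_i (c i)%:Z) => //; split=> //; first by move=> i; rewrite mxE.
  by rewrite ed opprK => i; rewrite mxE.
case=> v -> [rv pv nv]; split; split=> //.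
- by exists (fun i => `|v 0%R i|%N); rewrite root_comb_nat -nonneg_vecE.
- rewrite hw -root_comb_word.
  exact: (root_word_action root_vec_refl).
- exists (fun i => `|(- word_action A t v) 0%R i|%N).
  by rewrite root_comb_nat -nonneg_vecE // root_combN opprK hw root_comb_word.
Qed.

Section Series.
Variables (w : dual -> dual) (t : seq 'I_n).
Hypothesis hw : forall a, w a = dual_word_action t a.
Local Notation S := (inversion_subalgebra g w).

(** An upper bound for the [k]-th term of the lower central series, spanned by root vectors at the
    ends of chains. *)
Definition chain_span (k : nat) : set g :=
  lin_span [set x | exists2 v, inversion_chain A root_vec t k v & root_space g (phi v) x].

(** The weight of a nonzero bracket is nonzero, because [u] and [v] are nonnegative and [u] is not
    0; so [u + v] is a root. *)
Lemma lie_root_space u v x y : inversion A root_vec t u -> inversion A root_vec t v ->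
  root_space g (phi u) x -> root_space g (phi v) y -> lie x y != 0 ->
  inversion A root_vec t (u + v) /\ root_space g (phi (u + v)) (lie x y).
Proof.
move=> iu iv hx hy xy0.
have hxy : root_space g (phi (u + v)) (lie x y).
  by rewrite root_combD; exact: (weight_space_lie hx hy).
split=> //; rewrite -[u]scale1r -[v]scale1r; apply: inversion_comb => //.
rewrite !scale1r; split; last by exists (lie x y).
apply/eqP => /(root_comb_eq0 charF0) uv0; have [ru pu _] := iu; have [_ pv _] := iv.
apply: root_vec_neq0; rewrite -(_ : u = 0) //; apply/rowP => i.
by move: (pu i) (pv i); move/rowP/(_ i): uv0; rewrite row_intD !row_int0; lia.
Qed.

Lemma inversion_subalgebra_chain x : S x -> chain_span 0 x.
Proof.
have hS := lin_span_subspace; apply; split; last first.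
  move=> y [a /(inversion_setE hw)[v -> iv] hy]; apply: lin_span_gen.
  by exists v.
split=> [|y z]; first exact: hS.
apply: lin_span_lie2 => [|{}y {}z [u [iu _] hy] [v [iv _] hz]]; first exact: hS.
have [->|yz0] := eqVneq (lie y z) 0; first exact: (subspace0 (hS _ _ _)).
have [iuv huv] := lie_root_space iu iv hy hz yz0.
by apply: lin_span_gen; exists (u + v).
Qed.

Lemma lower_central_series_chain k x :
  lower_central_series S k x -> chain_span k x.
Proof.
have hS := lin_span_subspace; elim: k x => [|k IH] x /=.
  exact: inversion_subalgebra_chain.
apply: lin_span_le => [|_ [y [z [/inversion_subalgebra_chain hy /IH hz ->]]]]; first exact: hS.
move: y z hy hz; apply: lin_span_lie2 => [|y z [u [iu _] hy] [v cv hz]]; first exact: hS.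
have iv : inversion A root_vec t v by case: (k) cv => [|?] [].
have [->|yz0] := eqVneq (lie y z) 0; first exact: (subspace0 (hS _ _ _)).
have [iuv huv] := lie_root_space iu iv hy hz yz0.
by apply: lin_span_gen; exists (u + v) => //; split=> //; exists v, u.
Qed.

Lemma lower_central_series_eq0 : lower_central_series S (6 ^ n) = [set 0].
Proof.
apply/seteqP; split=> [x /lower_central_series_chain|_ ->]; last first.
  case: (6 ^ n)%N => [|k]; last exact: (subspace0 (lin_span_subspace _)).
  exact: (subspace0 (lie_generated_subalgebra _).1).
have [A2 _ _] := hA.
(* No chain of index [6 ^ n] exists, so the span is that of the empty set. *)
apply: lin_span_le => [|y [v]]; last first.
  by move/(inversion_chain_bound A2 root_vec_neq0 root_vec_sign root_vec_refl root_vec_multiple).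
split=> // a y z -> ->; rewrite scaler0; exact: addr0.
Qed.

End Series.
End InversionSubalgebra.

Theorem mainTheorem1 (n : nat) (A : 'M[int]_n)
    (hA : generalized_cartan_matrix A) :
  exists N : nat,
    forall (F : fieldType) (charF0 : [pchar F] =i pred0)
           (R : realization A F) (g : kac_moody_algebra R)
           (w : dual_space (cartan R) -> dual_space (cartan R)),
      weyl_group w ->
      exists d : nat,
        nilpotency_degree (inversion_subalgebra g w) d /\ (d <= N)%N.
Proof.
exists (6 ^ n)%N => F charF0 R g w /(weyl_group_word hA)[t hw].
pose P k := `[< lower_central_series (inversion_subalgebra g w) k = [set 0] >].
have PN : P (6 ^ n)%N by apply/asboolP; exact: lower_central_series_eq0 hw.
(* The degree is the least index at which the series vanishes. *)
case: (ex_minnP (ex_intro P _ PN)) => d /asboolP Pd min_d.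
by exists d; split; [split=> // k /asboolP /min_d | exact: min_d].
Qed.
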